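(* Suppose $\mathcal{Y}=\mathbb{R}^n$ and each $f_i$ is differentiable with $\nabla f_i$ Lipschitz continuous on $\mathbb{R}^n$ with constant $L_i>0$, $i=1,\dots,m$, and let $L=\max_iL_i$. Then the function $-g$ is strongly convex with constant $(1/L)\left[2-2\cos(\pi/m)\right]$.
   Context: Let $m\ge2$, $n\ge1$ be integers, $\mathcal{Y}\subseteq\mathbb{R}^n$ a closed convex set, and $f_i:\mathbb{R}^n\to\mathbb{R}$, $i=1,\dots,m$, strictly convex closed functions. For $\mathbf{y}=(\mathbf{y}_1,\dots,\mathbf{y}_m)\in(\mathbb{R}^n)^m=\mathbb{R}^{nm}$ put $f(\mathbf{y})=\sum_{i=1}^m f_i(\mathbf{y}_i)$, and $\mathbf{A}\mathbf{y}=(\mathbf{y}_1-\mathbf{y}_2,\dots,\mathbf{y}_{m-1}-\mathbf{y}_m)\in\mathbb{R}^{n(m-1)}$. The dual function, with values in the extended reals, is $g(\boldsymbol{\lambda})=\inf_{\mathbf{y}\in\mathcal{Y}^m}\big[f(\mathbf{y})+\boldsymbol{\lambda}^{T}\mathbf{A}\mathbf{y}\big]$, $\boldsymbol{\lambda}\in\mathbb{R}^{n(m-1)}$. Norms are Euclidean. A function $\varphi$ with values in $\mathbb{R}\cup\{+\infty\}$ is strongly convex with constant $\sigma>0$ if $\varphi((1-\theta)\mathbf{x}+\theta\mathbf{x}')\le(1-\theta)\varphi(\mathbf{x})+\theta\varphi(\mathbf{x}')-\frac{\sigma}{2}\theta(1-\theta)\|\mathbf{x}-\mathbf{x}'\|^2$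 for all $\mathbf{x},\mathbf{x}'$ and $\theta\in(0,1)$. *)

(* Defs.v *)
From HB Require Import structures.
From mathcomp Require Import all_boot all_order all_algebra.
From mathcomp Require Import all_classical all_reals all_analysis.

Set Implicit Arguments.
Unset Strict Implicit.
Unset Printing Implicit Defensive.

Import Order.TTheory GRing.Theory Num.Theory.
Import numFieldNormedType.Exports.

Local Open Scope classical_set_scope.
Local Open Scope ring_scope.

(* The library norm `|x| on matrices is the max norm. The Euclidean structure
   below is the one of R^(pq), so it covers both R^n = 'rV_n and stacked
   vectors, a point of (R^n)^p being the matrix in 'M_(p, n) whose i-th row is
   its i-th block. *)
Definition dotmx (R : realType) (p q : nat) (x y : 'M[R]_(p, q)) : R :=
  \sum_i \sum_j x i j * y i j.

Definition enorm (R : realType) (p q : nat) (x : 'M[R]_(p, q)) : R :=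
  Num.sqrt (dotmx x x).

Definition strictly_convex (R : realType) (n : nat) (f : 'rV[R]_n -> R) : Prop :=
  forall (x y : 'rV[R]_n) (t : R), x != y -> 0 < t < 1 ->
    f ((1 - t) *: x + t *: y) < (1 - t) * f x + t * f y.

(* closed function = function whose epigraph is a closed set *)
Definition closed_fun (R : realType) (n : nat) (f : 'rV[R]_n -> R) : Prop :=
  closed [set p : 'rV[R]_n * R | f p.1 <= p.2].

Definition gradient (R : realType) (n : nat) (f : 'rV[R]_n -> R)
    (x : 'rV[R]_n) : 'rV[R]_n :=
  \row_j 'D_(delta_mx 0 j) f x.

(* Lipschitz continuity on the whole space, for the Euclidean norm *)
Definition elipschitz (R : realType) (n : nat) (k : R)
    (F : 'rV[R]_n -> 'rV[R]_n) : Prop :=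
  forall x y : 'rV[R]_n, enorm (F x - F y) <= k * enorm (x - y).

Definition separable_sum (R : realType) (m n : nat)
    (f : 'I_m -> 'rV[R]_n -> R) (y : 'M[R]_(m, n)) : R :=
  \sum_i f i (row i y).

Definition this_ord (m : nat) (i : 'I_m.-1) : 'I_m := widen_ord (leq_pred m) i.

Fact next_ord_subproof (m : nat) (i : 'I_m.-1) : (i.+1 < m)%N.
Proof. by rewrite -ltn_predRL. Qed.

Definition next_ord (m : nat) (i : 'I_m.-1) : 'I_m :=
  Ordinal (next_ord_subproof i).

(* A y = (y_1 - y_2, ..., y_(m-1) - y_m) *)
Definition consensus_diff (R : realType) (m n : nat) (y : 'M[R]_(m, n)) :
    'M[R]_(m.-1, n) :=
  \matrix_(i < m.-1) (row (this_ord i) y - row (next_ord i) y).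

Definition dual_fun (R : realType) (m n : nat) (Y : set 'rV[R]_n)
    (f : 'I_m -> 'rV[R]_n -> R) (l : 'M[R]_(m.-1, n)) : \bar R :=
  ereal_inf [set (separable_sum f y + dotmx l (consensus_diff y))%:E
            | y in [set y : 'M[R]_(m, n) | forall i, Y (row i y)]].

(* Strong convexity with constant sigma > 0 of a function with values in
   R U {+oo}; as -oo is excluded, the right-hand side has no undefined sum. *)
Definition strongly_convex (R : realType) (p q : nat) (sigma : R)
    (phi : 'M[R]_(p, q) -> \bar R) : Prop :=
  [/\ 0 < sigma,
      forall x, phi x != -oo%E &
      forall (x x' : 'M[R]_(p, q)) (t : R), 0 < t < 1 ->
        (phi ((1 - t)%R *: x + t *: x')%R <=
         (1 - t)%:E * phi x + t%:E * phi x'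
         - (sigma / 2 * t * (1 - t) * enorm (x - x') ^+ 2)%R%:E)%E].

(* Main.v *)
(** Let [A] be the difference operator [consensus_diff].  A Lipschitz gradient
    bounds [f (y + d)] by its first-order expansion at [y] plus
    [L / 2 * |d|^2].  For multipliers [l], [l'] and a weight [t], evaluate the
    two Lagrangians at [y - t d] and [y + (1 - t) d]: in the [t]-weighted mean
    the gradient terms cancel, and [d = A^T (l - l') / L] leaves a gain of
    [t (1 - t) / (2 L) * |A^T (l - l')|^2].  Taking infima over [y], strong
    concavity of the dual function follows from
    [|A^T u|^2 >= (2 - 2 cos (pi / m)) |u|^2], the discrete Poincare inequality
    on a path with Dirichlet boundary conditions. *)

Require Import Defs.
From HB Require Import structures.
From mathcomp Require Import all_boot all_order all_algebra.
From mathcomp Require Import all_classical all_reals all_analysis.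
From mathcomp Require Import ring lra.

Import Order.TTheory GRing.Theory Num.Theory.
Import numFieldNormedType.Exports.

Local Open Scope classical_set_scope.
Local Open Scope ring_scope.

(* [Defs.dotmx] is otherwise shadowed by the form of the same name in MathComp. *)
Local Notation dotmx := Defs.dotmx.

(** * Euclidean inner product on stacked vectors *)

Section EuclideanProduct.
Context {R : realType} {p q : nat}.
Implicit Types (x y z : 'M[R]_(p, q)) (a : R).

Lemma dotmxC x y : dotmx x y = dotmx y x.
Proof. by apply: eq_bigr => i _; apply: eq_bigr => j _; rewrite mulrC. Qed.

Lemma dotmxDl x y z : dotmx (x + y) z = dotmx x z + dotmx y z.
Proof.
rewrite /dotmx -big_split; apply: eq_bigr => i _.
by rewrite -big_split; apply: eq_bigr => j _; rewrite mxE mulrDl.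
Qed.

Lemma dotmxZl a x y : dotmx (a *: x) y = a * dotmx x y.
Proof.
rewrite /dotmx mulr_sumr; apply: eq_bigr => i _.
by rewrite mulr_sumr; apply: eq_bigr => j _; rewrite mxE mulrA.
Qed.

Lemma dotmxDr x y z : dotmx x (y + z) = dotmx x y + dotmx x z.
Proof. by rewrite dotmxC dotmxDl !(dotmxC x). Qed.

Lemma dotmxZr a x y : dotmx x (a *: y) = a * dotmx x y.
Proof. by rewrite dotmxC dotmxZl dotmxC. Qed.

Lemma dotmxNl x y : dotmx (- x) y = - dotmx x y.
Proof. by rewrite -scaleN1r dotmxZl mulN1r. Qed.

Lemma dotmxNr x y : dotmx x (- y) = - dotmx x y.
Proof. by rewrite dotmxC dotmxNl dotmxC. Qed.

Lemma dotmx_ge0 x : 0 <= dotmx x x.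
Proof. by apply: sumr_ge0 => i _; apply: sumr_ge0 => j _; rewrite -expr2 sqr_ge0. Qed.

Lemma sqr_enorm x : enorm x ^+ 2 = dotmx x x.
Proof. by rewrite /enorm sqr_sqrtr ?dotmx_ge0. Qed.

Lemma enorm_ge0 x : 0 <= enorm x.
Proof. exact: sqrtr_ge0. Qed.

Lemma enormZ a x : 0 <= a -> enorm (a *: x) = a * enorm x.
Proof.
move=> a0; rewrite /enorm dotmxZl dotmxZr mulrA -expr2.
by rewrite sqrtrM ?sqr_ge0// sqrtr_sqr ger0_norm.
Qed.

(** Expanding [|x - a y|^2 >= 0] gives [2 a <x, y> <= |x|^2 + a^2 |y|^2], and the assumption bounds
    the right-hand side by [2 a^2 |y|^2]. *)
Lemma dotmx_le_enorm a x y :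
  0 < a -> enorm x <= a * enorm y -> dotmx x y <= a * dotmx y y.
Proof.
move=> a0 xy; rewrite -(ler_pM2l a0).
have : dotmx x x <= a ^+ 2 * dotmx y y.
  rewrite -!sqr_enorm -exprMn ler_sqr ?nnegrE ?enorm_ge0//.
  by rewrite mulr_ge0 ?enorm_ge0 ?ltW.
have := dotmx_ge0 (x - a *: y).
rewrite !(dotmxDl, dotmxDr, dotmxNl, dotmxNr, dotmxZl, dotmxZr) (dotmxC y x).
move: (dotmx x x) (dotmx x y) (dotmx y y) => u v w; nra.
Qed.

End EuclideanProduct.

Lemma dotmx_rows (R : realType) (p q : nat) (x y : 'M[R]_(p, q)) :
  dotmx x y = \sum_i dotmx (row i x) (row i y).
Proof.
apply: eq_bigr => i _; rewrite /dotmx big_ord1.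
by apply: eq_bigr => j _; rewrite !mxE.
Qed.

(** * Quadratic upper bounds from a Lipschitz gradient *)

Section Smoothness.
Context {R : realType} {n : nat}.
Variables (f : 'rV[R]_n -> R) (k : R).
Hypothesis f_diff : forall x, differentiable f x.

Lemma diff_gradient x d : 'd f x d = dotmx (gradient f x) d.
Proof.
rewrite {1}(row_sum_delta d) linear_sum /dotmx big_ord1.
apply: eq_bigr => j _; rewrite linearZ mxE -deriveE//.
by rewrite mulrC.
Qed.

Lemma is_derive_line x d (s : R) :
  is_derive s 1 (fun r : R => f (x + r *: d)) (dotmx (gradient f (x + s *: d)) d).
Proof.
pose h (r : R) := x + r *: d.
have dh : is_diff s h ( *:%R^~ d).
  have -> : ( *:%R^~ d) = (0 : R -> 'rV[R]_n) + ( *:%R^~ d).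
    by apply/funext => r /=; rewrite fctE add0r.
  exact: is_diffD.
have dc : differentiable (f \o h) s by apply: differentiable_comp.
have -> : (fun r : R => f (x + r *: d)) = f \o h by [].
apply: DeriveDef; first exact/derivable1_diffP.
rewrite deriveE// diff_comp//= diff_val/= scale1r.
exact: diff_gradient.
Qed.

Hypotheses (k_gt0 : 0 < k) (f_lip : elipschitz k (gradient f)).

(** The mean value theorem on [[0, 1]] is applied to [phi], the excess of [f] over its quadratic
    bound along the segment; its derivative is nonpositive, so [phi 1 <= phi 0]. *)
Lemma descent_le x d :
  f (x + d) <= f x + dotmx (gradient f x) d + k / 2 * dotmx d d.
Proof.
pose c := dotmx (gradient f x) d; pose e := k / 2 * dotmx d d.
pose phi (s : R) := f (x + s *: d) - (s * c + s ^+ 2 * e).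
pose dphi (s : R) := dotmx (gradient f (x + s *: d)) d - (c + 2 * s * e).
have phiD (s : R) : is_derive s 1 phi (dphi s).
  apply: is_deriveB; first exact: is_derive_line.
  apply: is_derive_eq.
  by rewrite /GRing.scale/=; ring.
have [s /[!in_itv]/= /andP[s0 s1]] : exists2 s, s \in `]0, 1[%R &
    phi 1 - phi 0 = dphi s * (1 - 0).
  apply: MVT => //; apply: continuous_subspaceT => s.
  by apply/differentiable_continuous/derivable1_diffP.
suff : dphi s <= 0.
  rewrite /phi scale1r scale0r addr0 -/c -/e; lra.
(* Between [x] and [x + s d] the gradient moves by at most [k s |d|], and [2 s e = k s |d|^2]. *)
have := @dotmx_le_enorm _ _ _ (k * s)
  (gradient f (x + s *: d) - gradient f x) d (mulr_gt0 k_gt0 s0).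
rewrite dotmxDl dotmxNl -/c /dphi /e.
have /[swap]/[apply] : enorm (gradient f (x + s *: d) - gradient f x)
    <= k * s * enorm d.
  rewrite -mulrA -(enormZ s d (ltW s0)).
  by have := f_lip (x + s *: d) x; rewrite [X in k * enorm X]addrAC subrr add0r.
lra.
Qed.

(** The displacements [- t d] and [(1 - t) d] have weighted mean zero, and their squares average to
    [t (1 - t) |d|^2]. *)
Lemma jensen_gap_le x d t : 0 <= t <= 1 ->
  (1 - t) * f (x - t *: d) + t * f (x + (1 - t) *: d)
    <= f x + k / 2 * (t * (1 - t)) * dotmx d d.
Proof.
move=> /andP[t0 t1]; have t1' : 0 <= 1 - t by lra.
have := ler_wpM2l t1' (descent_le x (- (t *: d))).
have := ler_wpM2l t0 (descent_le x ((1 - t) *: d)).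
rewrite !(dotmxNl, dotmxNr, dotmxZl, dotmxZr).
move: (dotmx (gradient f x) d) (dotmx d d) (f (x + _)) (f (x - _)) => u v w z.
lra.
Qed.

End Smoothness.

Arguments jensen_gap_le {R n f k} _ _ _ x d {t}.

(* [a i] below is compared with the positive eigenvector [sin (i * pi / m)] of
   the path Laplacian: the term [s k / s k.+1] solves the Riccati recursion
   which makes each induction step a perfect square. *)
Lemma dirichlet_poincare (R : realType) (m : nat) (a : nat -> R) :
  (2 <= m)%N -> a 0%N = 0 -> a m = 0 ->
  (2 - 2 * cos (pi / m%:R)) * \sum_(i < m) a i ^+ 2
    <= \sum_(i < m) (a i.+1 - a i) ^+ 2.
Proof.
move=> m2 a0 am; set c := cos _.
have m0 : 0 < m%:R :> R by rewrite ltr0n; exact: leq_trans m2.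
pose s k := sin (k%:R * (pi / m%:R)) : R.
have sS k : s k.+2 + s k = 2 * c * s k.+1.
  rewrite /s; set t := pi / m%:R.
  have -> : k.+2%:R * t = k.+1%:R * t + t by rewrite -(natr1 k.+1) mulrDl mul1r.
  have -> : k%:R * t = k.+1%:R * t - t by rewrite -(natr1 k) mulrDl mul1r addrK.
  by rewrite sinD sinB /c -/t; ring.
have s0 : s 0%N = 0 by rewrite /s mul0r sin0.
have sm : s m = 0 by rewrite /s mulrC divfK ?gt_eqF// sinpi.
have s_gt0 k : (0 < k < m)%N -> 0 < s k.
  move=> /andP[k0 km]; apply: sin_gt0_pi; rewrite mulr_gt0 ?ltr0n ?divr_gt0 ?pi_gt0//=.
  by rewrite mulrA ltr_pdivrMr// mulrC ltr_pM2l ?pi_gt0// ltr_nat.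
have inv k : (k.+1 < m)%N ->
    (2 - 2 * c) * \sum_(i < k.+1) a i ^+ 2 + (1 - s k / s k.+1) * a k.+1 ^+ 2
      <= \sum_(i < k.+1) (a i.+1 - a i) ^+ 2.
  elim: k => [|k IHk] km.
    by rewrite !big_ord1 a0 s0 subr0 expr0n/=; lra.
  rewrite big_ord_recr [leRHS]big_ord_recr/=.
  have := IHk (ltnW km).
  set A := \sum_(i < k.+1) a i ^+ 2; set B := \sum_(i < k.+1) (_ - _) ^+ 2.
  have u0 : 0 < s k.+1 by rewrite s_gt0//= ltnW.
  have v0 : 0 < s k.+2 by rewrite s_gt0.
  have -> : s k = 2 * c * s k.+1 - s k.+2 by rewrite -sS; ring.
  move: (s k.+1) (s k.+2) u0 v0 (a k.+1) (a k.+2) => u v u0 v0 x y IH.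
  have sq : 0 <= (v * x - u * y) ^+ 2 / (u * v).
    by rewrite divr_ge0 ?sqr_ge0// mulr_ge0 ?ltW.
  rewrite -subr_ge0.
  have -> : B + (y - x) ^+ 2 - ((2 - 2 * c) * (A + x ^+ 2) + (1 - u / v) * y ^+ 2)
    = (B - ((2 - 2 * c) * A + (1 - (2 * c * u - v) / u) * x ^+ 2)) +
      (v * x - u * y) ^+ 2 / (u * v).
    by field; rewrite !gt_eqF.
  by rewrite addr_ge0// subr_ge0.
(* At the right end [s m = 0] turns the ratio into [2 c]; the last difference adds one more
   [a k.+1 ^+ 2], so its coefficient [1 - 2 c] becomes [2 - 2 c]. *)
case: m m2 am m0 @c s sS s0 sm s_gt0 inv => [|[|k]]// _ am _ c s sS s0 sm s_gt0 inv.
rewrite big_ord_recr [leRHS]big_ord_recr/= am sub0r sqrrN.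
have := inv k (ltnSn _); have := sS k; rewrite sm add0r => ->.
rewrite mulfK ?gt_eqF ?s_gt0 ?ltnSn//; lra.
Qed.

(** * The difference operator and its adjoint *)

Section ConsensusDiff.
Context {R : realType} {m n : nat}.
Implicit Types (l : 'M[R]_(m.-1, n)) (x y : 'M[R]_(m, n)).

Lemma consensus_diffD x y :
  consensus_diff (x + y) = consensus_diff x + consensus_diff y.
Proof. by apply/matrixP => i j; rewrite !mxE; ring. Qed.

Lemma consensus_diffZ a x : consensus_diff (a *: x) = a *: consensus_diff x.
Proof. by apply/matrixP => i j; rewrite !mxE; ring. Qed.

(* The [j]-th column of [l], shifted by one and extended by [0] on both sides. *)
Definition padded_col l (j : 'I_n) (k : nat) : R :=
  if k is k'.+1 then (if insub k' is Some i then l i j else 0) else 0.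

Lemma padded_col0 l j : padded_col l j 0 = 0.
Proof. by []. Qed.

Lemma padded_colS l j (i : 'I_m.-1) : padded_col l j i.+1 = l i j.
Proof. by rewrite /padded_col valK. Qed.

(** This is [A^T]; the zero padding covers the first and last rows by the same formula. *)
Definition consensus_adj l : 'M[R]_(m, n) :=
  \matrix_(k, j) (padded_col l j k.+1 - padded_col l j k).

End ConsensusDiff.

Arguments padded_col : simpl never.

Lemma padded_col_last (R : realType) (m n : nat) (l : 'M[R]_(m.-1, n)) j :
  padded_col l j m = 0.
Proof. by case: m l => // m l; rewrite /padded_col insubF// ltnn. Qed.

(** Summation by parts in each column; the boundary terms vanish by the padding. *)
Lemma dotmx_consensus_adj (R : realType) (m n : nat) (l : 'M[R]_(m.-1, n))
    (y : 'M[R]_(m, n)) :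
  (0 < m)%N -> dotmx l (consensus_diff y) = dotmx (consensus_adj l) y.
Proof.
case: m l y => // m l y _; rewrite /dotmx exchange_big [RHS]exchange_big/=.
apply: eq_bigr => j _.
under [RHS]eq_bigr do rewrite mxE mulrBl.
rewrite [RHS]sumrB big_ord_recr/= (padded_col_last R m.+1) mul0r addr0.
rewrite [X in _ = _ - X]big_ord_recl/= padded_col0 mul0r add0r -sumrB.
apply: eq_bigr => i _; rewrite !mxE mulrBr; congr (_ - _).
  rewrite -(@padded_colS R m.+1 n l); congr (_ * y _ j); exact/val_inj.
by rewrite /bump/= add1n -(@padded_colS R m.+1 n l); congr (_ * y _ j); exact/val_inj.
Qed.

Lemma dotmx_consensus_adj_ge (R : realType) (m n : nat) (l : 'M[R]_(m.-1, n)) :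
  (2 <= m)%N ->
  (2 - 2 * cos (pi / m%:R)) * dotmx l l
    <= dotmx (consensus_adj l) (consensus_adj l).
Proof.
move=> m2; rewrite /dotmx exchange_big [leRHS]exchange_big/= mulr_sumr.
apply: ler_sum => j _.
have := dirichlet_poincare R m (padded_col l j) m2 erefl (padded_col_last R m n l j).
congr (_ * _ <= _); last by apply: eq_bigr => i _; rewrite !mxE.
(* The padded column has a leading zero; dropping it leaves the [m - 1] entries of [l]. *)
case: m l m2 => // m l _; rewrite big_ord_recl/= padded_col0 expr0n add0r.
by apply: eq_bigr => i _; rewrite /bump/= add1n (@padded_colS R m.+1 n l).
Qed.

(** * Lagrangian and dual function *)

Section DualFunction.
Context {R : realType} {m n : nat}.
Variables (f : 'I_m -> 'rV[R]_n -> R) (L : 'I_m -> R).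
Hypotheses (m_ge2 : (2 <= m)%N)
  (f_diff : forall i x, differentiable (f i) x)
  (L_gt0 : forall i, 0 < L i)
  (f_lip : forall i, elipschitz (L i) (gradient (f i))).

(** The starting value [0] lies below every [L i], so over the nonempty ['I_m] this is the true
    maximum. *)
Let Lmax := \big[Num.max/0]_(i < m) L i.

Lemma le_Lmax i : L i <= Lmax.
Proof. exact: le_bigmax. Qed.

Lemma Lmax_gt0 : 0 < Lmax.
Proof.
have m0 : (0 < m)%N by exact: leq_trans m_ge2.
exact: lt_le_trans (L_gt0 (Ordinal m0)) (le_Lmax _).
Qed.

Lemma separable_jensen_gap_le (y d : 'M[R]_(m, n)) (t : R) : 0 <= t <= 1 ->
  (1 - t) * separable_sum f (y - t *: d)
    + t * separable_sum f (y + (1 - t) *: d)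
    <= separable_sum f y + Lmax / 2 * (t * (1 - t)) * dotmx d d.
Proof.
move=> t01; rewrite dotmx_rows !mulr_sumr -!big_split/=.
apply: ler_sum => i _; rewrite !linearD !linearZ/= linearN scalerN.
apply: le_trans (jensen_gap_le (f_diff i) (L_gt0 i) (f_lip i) _ _ t01) _.
rewrite lerD2l ler_wpM2r ?dotmx_ge0// ler_wpM2r ?ler_pM2r ?le_Lmax//.
by case/andP: t01 => t0 t1; rewrite mulr_ge0// subr_ge0.
Qed.

Definition lagrangian (l : 'M[R]_(m.-1, n)) (y : 'M[R]_(m, n)) : R :=
  separable_sum f y + dotmx l (consensus_diff y).

(* Perturbing [y] by multiples of [d] with zero mean cancels the first-order
   terms of [f]; [d] maximises the remaining concave quadratic. *)
Lemma lagrangian_gap (l l' : 'M[R]_(m.-1, n)) (y : 'M[R]_(m, n)) (t : R) :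
  0 <= t <= 1 ->
  let d := Lmax^-1 *: consensus_adj (l - l') in
  (1 - t) * lagrangian l (y - t *: d) + t * lagrangian l' (y + (1 - t) *: d)
    + (1 / Lmax * (2 - 2 * cos (pi / m%:R))) / 2 * t * (1 - t)
      * enorm (l - l') ^+ 2
    <= lagrangian ((1 - t) *: l + t *: l') y.
Proof.
move=> t01 /=; set d := _ *: consensus_adj _.
have := separable_jensen_gap_le y d t t01.
have := dotmx_consensus_adj_ge _ _ _ (l - l') m_ge2.
(* Both identities use [A^T (l - l') = Lmax d]. *)
have : dotmx (l - l') (consensus_diff d) = Lmax * dotmx d d.
  rewrite dotmx_consensus_adj ?(leq_trans _ m_ge2)// dotmxZl dotmxZr.
  by rewrite mulVKf ?gt_eqF ?Lmax_gt0// dotmxZr.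
have -> : dotmx (consensus_adj (l - l')) (consensus_adj (l - l'))
    = Lmax ^+ 2 * dotmx d d.
  rewrite dotmxZl dotmxZr expr2 -mulrA mulVKf ?gt_eqF ?Lmax_gt0//.
  by rewrite mulVKf ?gt_eqF ?Lmax_gt0.
rewrite sqr_enorm /lagrangian -(scaleNr t d).
set N := dotmx (l - l') (l - l'); set q := dotmx d d; set c := 2 - 2 * cos _.
clearbody N q d.
rewrite !consensus_diffD !consensus_diffZ.
rewrite !(dotmxDl, dotmxDr, dotmxNl, dotmxZl, dotmxZr).
move=> /eqP; rewrite subr_eq => /eqP -> cN gap.
have tt : 0 <= t * (1 - t).
  by case/andP: t01 => t0 t1; rewrite mulr_ge0// subr_ge0.
have cNq : 1 / Lmax * c * N <= Lmax * q.
  by rewrite mul1r -mulrA mulrC ler_pdivrMr ?Lmax_gt0// mulrAC -expr2.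
(* The multiplier terms contribute [- t (1 - t) Lmax q] and [gap] gives back at most half of it; the
   remaining half dominates the term in [N]. *)
have := ler_wpM2l tt cNq; lra.
Qed.

Lemma dual_fun_le_lagrangian l y :
  (dual_fun [set: 'rV[R]_n] f l <= (lagrangian l y)%:E)%E.
Proof. by apply: ereal_inf_lbound; exists y. Qed.

Lemma dual_fun_neq_pinfty l : dual_fun [set: 'rV[R]_n] f l != +oo%E.
Proof. by rewrite -ltey (le_lt_trans (dual_fun_le_lagrangian l 0))// ltry. Qed.

End DualFunction.

Theorem proposition2 (R : realType) (m n : nat)
    (f : 'I_m -> 'rV[R]_n -> R) (L : 'I_m -> R)
    (m_ge2 : (2 <= m)%N) (n_ge1 : (1 <= n)%N)
    (f_strict : forall i, strictly_convex (f i))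
    (f_closed : forall i, closed_fun (f i))
    (f_diff : forall i x, differentiable (f i) x)
    (L_gt0 : forall i, 0 < L i)
    (f_lip : forall i, elipschitz (L i) (gradient (f i))) :
  let Lmax := \big[Num.max/0]_(i < m) L i in
  strongly_convex ((1 / Lmax) * (2 - 2 * cos (pi / m%:R)))
    (fun l : 'M[R]_(m.-1, n) => (- dual_fun [set: 'rV[R]_n] f l)%E).
Proof.
move=> Lmax; split.
(* Since [0 < pi / m <= pi] and [cos] decreases strictly on [[0, pi]], [cos (pi / m) < 1]. *)
- rewrite mulr_gt0 ?divr_gt0 ?(Lmax_gt0 _ m_ge2 L_gt0)// subr_gt0.
  rewrite gtr_pMr// -[ltRHS]cos0 ltr_cos ?in_itv/= ?lexx ?pi_ge0//.
    by rewrite divr_gt0 ?pi_gt0 ?ltr0n ?(leq_trans _ m_ge2).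
  rewrite divr_ge0 ?pi_ge0//= ler_pdivrMr ?ltr0n ?(leq_trans _ m_ge2)//.
  by rewrite ler_peMr ?pi_ge0// ler1n (leq_trans _ m_ge2).
- by move=> l; rewrite eqe_oppLR; exact: dual_fun_neq_pinfty.
move=> l l' t /andP[t0 t1]; have t1' : 0 < 1 - t by rewrite subr_gt0.
have := dual_fun_neq_pinfty f l; have := dual_fun_neq_pinfty f l'.
have := dual_fun_le_lagrangian f l; have := dual_fun_le_lagrangian f l'.
case: (dual_fun _ f l) => [g||]//; case: (dual_fun _ f l') => [g'||]// g'P gP _ _.
(* Both dual values are finite: every Lagrangian value at the mean multiplier is bounded below, the
   shifted points being admissible because [Y] is the whole space. *)
- rewrite leeNl; apply: le_ereal_inf_tmp => _ [y _ <-].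
  rewrite -!EFinN lee_fin.
  set d := Lmax^-1 *: consensus_adj (l - l').
  have t01 : 0 <= t <= 1 by rewrite !ltW.
  apply: le_trans (lagrangian_gap _ _ m_ge2 f_diff L_gt0 f_lip l l' y t t01).
  rewrite -/Lmax -/d.
  have := gP (y - t *: d); have := g'P (y + (1 - t) *: d).
  rewrite !lee_fin => /(ler_wpM2l (ltW t0)) ? /(ler_wpM2l (ltW t1')) ?; lra.
(* Once a dual value is [-oo], positivity of the weights makes the right-hand side [+oo]. *)
- by rewrite /= gt0_muley ?lte_fin// addey ?addye ?leey.
- by rewrite /= gt0_muley ?lte_fin// !addye ?leey.
- by rewrite /= !gt0_muley ?lte_fin// !addye ?leey.
Qed.
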